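(* Let $G$ be a digraph with an oriented near $\alpha$-valuation $p$, with associated partition $V(G)=V_{small}\cup V_{large}$, and let $l$ be a positive integer. Let $G_{1,l}$ be the digraph obtained from $G$ by replacing each vertex $s\in V_{small}$ by a single vertex and each vertex $s\in V_{large}$ by a set $V_s$ of $l$ vertices, and replacing each arc $(u,v)$ of $G$ by all arcs from the vertices replacing $u$ to the vertices replacing $v$. Then $G_{1,l}$ admits an oriented near $\alpha$-valuation.
   Context: Digraphs are oriented graphs. For a digraph $G$ with $n$ arcs, an oriented $\beta$-valuation is an injective $b:V(G)\to\{0,\ldots,n\}$ such that the multiset $\{b(v)-b(u)\bmod (n+1):(u,v)\text{ an arc}\}$ equals $\mathbb{Z}_{n+1}\setminus\{0\}$ (elements of $\mathbb{Z}_{n+1}$ identified with $0,\ldots,n$). An oriented near $\alpha$-valuation is an oriented $\beta$-valuation $b$ with a partition $V(G)=V_{small}\cup V_{large}$ such that each $v\in V_{small}$ has $b(v)<b(u)$ for all $u$ adjacent to $v$ in the underlying undirected graph, and each $v\in V_{large}$ has $b(v)>b(u)$ for all such $u$. *)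

(* Defs.v *)
From HB Require Import structures.
From mathcomp Require Import all_boot all_algebra.

Set Implicit Arguments.
Unset Strict Implicit.
Unset Printing Implicit Defensive.

Import GRing.Theory.

Local Open Scope nat_scope.

(* Finite oriented graphs: asymmetry rules out both loops and pairs of
   opposite arcs. *)
Record digraph := Digraph {
  vertex :> finType;
  arc : rel vertex;
  arc_asym : forall u v, arc u v -> ~~ arc v u
}.

Definition arcs (G : digraph) : {set G * G} := [set a | arc a.1 a.2].

Definition narcs (G : digraph) : nat := #|arcs G|.

Definition adjacent (G : digraph) : rel G := fun u v => arc u v || arc v u.

(* Z_{n+1} is 'I_n.+1 with its canonical additive group structure, so the
   subtraction below is subtraction modulo n + 1. *)
Definition oriented_beta_valuation (G : digraph)
    (b : G -> 'I_(narcs G).+1) : Prop :=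
  injective b /\
  perm_eq [seq (b a.2 - b a.1)%R | a in arcs G] (enum [set~ ord0]).

(* [partition] demands nonempty blocks, and [Vsmall != Vlarge] that there are
   two of them.  Nonemptiness only matters for arcless graphs: if there is an
   arc, one of its ends is in [Vsmall] and the other one in [Vlarge]. *)
Definition oriented_near_alpha_with (G : digraph) (b : G -> 'I_(narcs G).+1)
    (Vsmall Vlarge : {set G}) : Prop :=
  [/\ oriented_beta_valuation b,
      Vsmall != Vlarge /\ partition [set Vsmall; Vlarge] [set: G],
      forall v u, v \in Vsmall -> adjacent v u -> b v < b u &
      forall v u, v \in Vlarge -> adjacent v u -> b u < b v].

Definition oriented_near_alpha_valuation (G : digraph)
    (b : G -> 'I_(narcs G).+1) : Prop :=
  exists Vsmall Vlarge : {set G}, oriented_near_alpha_with b Vsmall Vlarge.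

(* Replace each vertex s by m s vertices (the pairs (s, i) with i < m s) and
   each arc by all arcs between the corresponding sets. *)
Section BlowUp.
Variables (G : digraph) (m : G -> nat).

Definition blowup_vertex : finType := {s : G & 'I_(m s)}.

Definition blowup_arc : rel blowup_vertex :=
  fun x y => arc (tag x) (tag y).

Lemma blowup_arc_asym x y : blowup_arc x y -> ~~ blowup_arc y x.
Proof. exact: arc_asym. Qed.

Definition blowup : digraph := Digraph blowup_arc_asym.
End BlowUp.

(* The graph G_{1,l}; the vertices outside [Vlarge] are those of V_small. *)
Definition blowup1 (G : digraph) (Vlarge : {set G}) (l : nat) : digraph :=
  blowup (fun s : G => if s \in Vlarge then l else 1).

(* Main.v *)
(** For [l] copies of the large vertices, send the small vertex [s] to [l * p s]
    and the copies of the large vertex [s] to the [l] consecutive values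
    [l * p s - i], [0 <= i < l].  An arc whose old label is [e] in
    [1, ..., n] is replaced by [l] arcs whose labels modulo [n * l + 1] fill the
    block [l * (e - 1) + 1, ..., l * e], and these blocks tile [1, ..., n * l].
    This breaks down only when a large vertex is labelled [0]; that vertex is
    isolated, so its copies [i > 0] may take the values [l * p t - i], which no
    vertex uses when [t] is small. *)
Require Import Defs.
From HB Require Import structures.
From mathcomp Require Import all_boot all_algebra zify.

Set Implicit Arguments.
Unset Strict Implicit.
Unset Printing Implicit Defensive.

Local Open Scope nat_scope.

(** For [i < l] and [a > 0], [l * a - i] lies in the block from [l * (a - 1) + 1] to [l * a], and
    distinct blocks are disjoint. The positivity conditions prevent truncated subtraction from
    sending every [l * 0 - i] to 0. *)
Lemma muln_subn_inj (l a b i j : nat) : i < l -> j < l ->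
  (0 < i -> 0 < a) -> (0 < j -> 0 < b) ->
  l * a - i = l * b - j -> a = b /\ i = j.
Proof.
move=> il jl ia jb E.
have la : i <= l * a by case: (posnP i) => [->|/ia] //; nia.
have lb : j <= l * b by case: (posnP j) => [->|/jb] //; nia.
have lt c d : c < d -> l * c + l <= l * d by rewrite -mulnSr leq_mul2l orbC => ->.
have ab : a = b by case: (ltngtP a b) => // /lt; lia.
by split => //; move: E la lb; rewrite ab; lia.
Qed.

Lemma val_ord_subr (n : nat) (x y : 'I_n.+1) :
  (y - x)%R = (if x <= y then y - x else n.+1 + y - x) :> nat.
Proof.
rewrite /= modnDmr; have := ltn_ord x; have := ltn_ord y.
case: (leqP x y) => xy yn xn.
  have -> : y + (n.+1 - x) = (y - x) + n.+1 by lia.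
  by rewrite modnDr modn_small //; lia.
by rewrite modn_small; lia.
Qed.

(** Pigeonhole: there are exactly [#|A|] nonzero residues, so injectivity on [A] already gives
    surjectivity onto them. *)
Lemma perm_image_nonzero (T : finType) (A : {set T}) (f : T -> 'I_#|A|.+1) :
  {in A &, injective f} -> (forall x, x \in A -> f x != ord0) ->
  perm_eq [seq f x | x in A] (enum [set~ (ord0 : 'I_#|A|.+1)]).
Proof.
move=> finj fnz.
have Uf : uniq [seq f x | x in A] by apply/dinjectiveP.
apply: uniq_perm (enum_uniq _) _ => //.
have sub : {subset [seq f x | x in A] <= enum [set~ ord0]}.
  by move=> y /imageP[x xA ->]; rewrite mem_enum !inE fnz.
case: (uniq_min_size Uf sub) => //.
by rewrite size_image -cardE cardsC1 card_ord.
Qed.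

(** * The partition and the arc labels of the original graph *)

Section BlowUpLarge.

Variables (G : digraph) (p : G -> 'I_(narcs G).+1).
Variables (Vsmall Vlarge : {set G}) (l : nat).
Hypotheses (hp : oriented_near_alpha_with p Vsmall Vlarge) (hl : 0 < l).

Let H := blowup1 Vlarge l.
Let index (x : H) : nat := tagged x.

Lemma small_nonempty : exists t, t \in Vsmall.
Proof.
case: hp => _ [_ /and3P[_ _ n0]] _ _.
by apply/set0Pn; apply: contraNneq n0 => <-; rewrite !inE eqxx.
Qed.

Lemma large_nonempty : exists t, t \in Vlarge.
Proof.
case: hp => _ [_ /and3P[_ _ n0]] _ _.
by apply/set0Pn; apply: contraNneq n0 => <-; rewrite !inE eqxx orbT.
Qed.

Lemma smallE s : (s \in Vsmall) = (s \notin Vlarge).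
Proof.
case: hp => _ [ne /and3P[/eqP cov triv _]] _ _.
have dis : [disjoint Vsmall & Vlarge].
  by move/trivIsetP: triv; apply; rewrite ?inE ?eqxx ?orbT.
apply/idP/idP => [sS|sL]; first by rewrite (disjointFr dis sS).
have : s \in cover [set Vsmall; Vlarge] by rewrite cov inE.
by case/bigcupP => B; rewrite !inE => /orP[] /eqP -> //; rewrite (negPf sL).
Qed.

Lemma arc_label_inj : {in arcs G &, injective (fun a => p a.2 - p a.1)%R}.
Proof.
case: hp => [[_ per]] _ _ _.
by apply/dinjectiveP; rewrite /dinjectiveb (perm_uniq per) enum_uniq.
Qed.

Lemma arc_label_gt0 u v : Defs.arc u v -> 0 < (p v - p u)%R.
Proof.
case: hp => [[_ per]] _ _ _ uv.
have : (p v - p u)%R \in enum [set~ (ord0 : 'I_(narcs G).+1)].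
  by rewrite -(perm_mem per); apply/imageP; exists (u, v); rewrite ?inE.
by rewrite mem_enum !inE -val_eqE lt0n.
Qed.

Lemma arc_smallNlarge u v : Defs.arc u v -> (u \in Vlarge) = (v \notin Vlarge).
Proof.
case: hp => _ _ hS hL uv.
have auv : adjacent u v by rewrite /adjacent uv.
have avu : adjacent v u by rewrite /adjacent uv orbT.
case uL: (u \in Vlarge); case vL: (v \in Vlarge) => //=.
  by have := hL _ _ uL auv; have := hL _ _ vL avu; lia.
have uS : u \in Vsmall by rewrite smallE uL.
have vS : v \in Vsmall by rewrite smallE vL.
by have := hS _ _ uS auv; have := hS _ _ vS avu; lia.
Qed.

(** * Copies of vertices and the number of arcs of the blow-up *)

Lemma ltn_index (x : H) : index x < l.
Proof. by rewrite /index; case: x => s [i] /=; case: ifP => _; lia. Qed.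

Lemma index_small (x : H) : tag x \notin Vlarge -> index x = 0.
Proof. by rewrite /index; case: x => s [i] /=; case: ifP => _; lia. Qed.

Lemma blowup_vertex_inj (x y : H) : tag x = tag y -> index x = index y -> x = y.
Proof.
rewrite /index; case: x y => [s i] [s' j] /= E; subst s' => ij.
by congr existT; apply: val_inj.
Qed.

Lemma blowup_size_gt0 s : 0 < (if s \in Vlarge then l else 1).
Proof. by case: ifP. Qed.

(** Reducing [i] modulo the number of copies makes every [i] legal at every vertex; at a small
    vertex all of them give the single copy. *)
Let copy (s : G) (i : nat) : H := existT _ s (Ordinal (ltn_pmod i (blowup_size_gt0 s))).

Lemma index_copy s i : i < l -> index (copy s i) = if s \in Vlarge then i else 0.
Proof. by rewrite /index /=; case: ifP => _ il; rewrite ?modn1 ?modn_small. Qed.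

Lemma narcs_blowup1 : narcs H = narcs G * l.
Proof.
(* The same index serves both ends: exactly one end is large and keeps it, while the small end
   forgets it. *)
pose g (c : (G * G) * 'I_l) : H * H := (copy c.1.1 c.2, copy c.1.2 c.2).
have -> : narcs G * l = #|setX (arcs G) [set: 'I_l]|.
  by rewrite cardsX cardsT card_ord.
rewrite -(card_in_imset (f := g)); last first.
  move=> [[u v] i] [[u' v'] j]; rewrite !inE !andbT /= => uv _ E.
  have Eu : copy u i = copy u' j by apply: (congr1 fst E).
  have Ev : copy v i = copy v' j by apply: (congr1 snd E).
  have uu : u = u' by apply: (congr1 (@tag _ _) Eu).
  have vv : v = v' by apply: (congr1 (@tag _ _) Ev).
  subst u' v'; congr (_, _); apply: val_inj => /=.
  have := arc_smallNlarge uv; have := congr1 index Eu; have := congr1 index Ev.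
  by rewrite !index_copy //; case: (v \in Vlarge) => //= _ + uL; rewrite uL.
apply: eq_card => -[x y]; apply/idP/imsetP => [|[[[u v] i]]]; last first.
  by rewrite !inE /= andbT => uv [-> ->].
rewrite inE => xy; have xy' : Defs.arc (tag x) (tag y) by [].
(* Only the large end can have a nonzero index, so the sum is the index of that end, whichever it
   is. *)
have il : index x + index y < l.
  have := ltn_index x; have := ltn_index y; have := arc_smallNlarge xy'.
  case yL: (tag y \in Vlarge) => /= xL.
    by rewrite (@index_small x) // xL.
  by rewrite (@index_small y) ?yL // addn0.
exists ((tag x, tag y), Ordinal il); first by rewrite !inE andbT.
have := arc_smallNlarge xy' => xyL.
congr (_, _); apply: blowup_vertex_inj; rewrite //= index_copy //=.
  case: ifP xyL => [_ /esym yL|xL _]; last by rewrite index_small ?xL.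
  by rewrite (index_small yL) addn0.
case: ifP xyL => [_ /negbT xL|yL _]; last by rewrite index_small ?yL.
by rewrite (index_small xL).
Qed.

(** * The vertex labelling and its injectivity *)

Variables (t : G) (tS : t \in Vsmall).

Let base (x : H) : nat :=
  if (0 < index x) && (p (tag x) == 0 :> nat) then p t else p (tag x).
Let label (x : H) : nat := l * base x - index x.

Lemma base_gt0 x : 0 < index x -> 0 < base x.
Proof.
case: hp => [[pinj _]] _ _ _.
rewrite /base => ix; rewrite ix /=; case: eqP => [p0|]; last by lia.
rewrite lt0n; apply/eqP => pt0.
have E : tag x = t by apply/pinj/val_inj; rewrite /= p0 pt0.
by move: tS; rewrite smallE -E => /index_small; lia.
Qed.

Lemma base_small x : tag x \notin Vlarge -> base x = p (tag x).
Proof. by rewrite /base => /index_small ->. Qed.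

Lemma base_large x : 0 < p (tag x) -> base x = p (tag x).
Proof. by rewrite /base lt0n => /negPf ->; rewrite andbF. Qed.

(** The borrowed value [p t] is used only at positive index, where it meets no other vertex: [t] is
    small, so its only copy has index 0. *)
Lemma base_inj x y : index x = index y -> base x = base y -> tag x = tag y.
Proof.
case: hp => [[pinj _]] _ _ _ ixy E; apply/pinj/val_inj => /=.
have tP z : 0 < index z -> p (tag z) <> p t :> nat.
  move=> iz /val_inj/pinj zt.
  by move: tS iz; rewrite smallE -zt => /index_small ->.
move: E; rewrite /base ixy; case: (posnP (index y)) => //= iy.
have ix : 0 < index x by rewrite ixy.
case: eqP => xp; case: eqP => yp //= E; first by rewrite xp yp.
- by case: (tP y iy).
- by case: (tP x ix).
Qed.

Lemma label_inj : injective label.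
Proof.
move=> x y E.
have [bE iE] := muln_subn_inj (ltn_index x) (ltn_index y)
  (@base_gt0 x) (@base_gt0 y) E.
exact: blowup_vertex_inj (base_inj iE bE) iE.
Qed.

Lemma label_bound x : label x < (narcs H).+1.
Proof.
rewrite narcs_blowup1 ltnS mulnC (leq_trans (leq_subr _ _)) // leq_mul2l.
by rewrite /base; case: ifP => _; rewrite -ltnS ltn_ord orbT.
Qed.

Let b (x : H) : 'I_(narcs H).+1 := Ordinal (label_bound x).

Lemma b_inj : injective b.
Proof. by move=> x y /(congr1 val) /label_inj. Qed.

(** * Labels along the arcs of the blow-up *)

Lemma label_adjacent x y : adjacent (tag x) (tag y) -> tag y \in Vlarge ->
  [/\ tag x \notin Vlarge, p (tag x) < p (tag y), label x = l * p (tag x)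
    & label y = l * p (tag y) - index y].
Proof.
case: hp => _ _ _ hL xy yL.
have pxy : p (tag x) < p (tag y) by apply: hL; rewrite // /adjacent orbC.
have xL : tag x \notin Vlarge.
  by case/orP: xy => /arc_smallNlarge; rewrite yL => // ->.
split => //; rewrite /label ?(base_small xL) ?(index_small xL) ?subn0 //.
(* The large end exceeds its neighbour, so its old label is positive and nothing is borrowed. *)
by rewrite base_large //; lia.
Qed.

Lemma label_lt x y : adjacent (tag x) (tag y) -> tag y \in Vlarge ->
  label x < label y.
Proof.
move=> xy yL; case: (label_adjacent xy yL) => _ pxy -> ->.
have := leq_mul2l l (p (tag x)).+1 (p (tag y)); rewrite pxy orbT mulnS.
by have := ltn_index y; lia.
Qed.

(* Position of the arc below the top [l * e] of the block of its old label. *)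
Let offset (a : H * H) : nat :=
  if tag a.2 \in Vlarge then index a.2 else l.-1 - index a.1.

Lemma offset_lt a : offset a < l.
Proof. by rewrite /offset; have := ltn_index a.2; case: ifP; lia. Qed.

Lemma blowup_arc_label (x y : H) : Defs.arc x y ->
  (b y - b x)%R = l * (p (tag y) - p (tag x))%R - offset (x, y) :> nat.
Proof.
move=> xy; have xy' : Defs.arc (tag x) (tag y) by [].
rewrite !val_ord_subr /= /offset /= narcs_blowup1.
have := ltn_index x; have := ltn_index y => iy ix.
have := ltn_ord (p (tag x)) => pxn.
case yL: (tag y \in Vlarge).
  have axy : adjacent (tag x) (tag y) by rewrite /adjacent xy'.
  have := label_lt axy yL; case: (label_adjacent axy yL) => _ pxy -> ->.
  by move=> lt; rewrite (ltnW lt) (ltnW pxy) mulnBr subnAC.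
have xL : tag x \in Vlarge by rewrite (arc_smallNlarge xy') yL.
have ayx : adjacent (tag y) (tag x) by rewrite /adjacent xy' orbT.
have := label_lt ayx xL; case: (label_adjacent ayx xL) => _ pyx -> ->.
(* Both differences wrap around. With [n = narcs G], the new modulus is
   [n * l + 1 = l * (n + 1) - (l - 1)], whence the reversed offset [l.-1 - index x]. *)
move=> lt; rewrite leqNgt lt leqNgt pyx /= mulnBr mulnDr mulnS.
have : l * p (tag x) <= l * narcs G by rewrite leq_mul2l -ltnS pxn orbT.
by rewrite mulnC; lia.
Qed.

(** A new arc label determines both the old label and the offset. The old label gives back the arc
    of [G], and the offset gives back the copy of its large end. *)
Lemma b_beta : oriented_beta_valuation b.
Proof.
split; first exact: b_inj.
apply: perm_image_nonzero => [[x y] [x' y']|[x y]]; rewrite !inE /=; last first.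
  move=> xy; have xy' : Defs.arc (tag x) (tag y) by [].
  (* The old label is at least 1 and the offset is below [l], so the new label is nonzero. *)
  rewrite -val_eqE -lt0n [val _](blowup_arc_label xy).
  have := arc_label_gt0 xy'; have := offset_lt (x, y); nia.
move=> xy xy1; have e0 := @arc_label_gt0 (tag x) (tag y) xy.
have e1 := @arc_label_gt0 (tag x') (tag y') xy1.
move/(congr1 val); rewrite /= [LHS](blowup_arc_label xy) [RHS](blowup_arc_label xy1).
case/(muln_subn_inj (offset_lt _) (offset_lt _) (fun=> e0) (fun=> e1)).
move=> /val_inj eE oE.
have [tx ty] : (tag x, tag y) = (tag x', tag y').
  by apply: arc_label_inj; rewrite ?inE.
have xyL := arc_smallNlarge (xy : Defs.arc (tag x) (tag y)).
move: oE; rewrite /offset /= -ty; case: ifP xyL => yL /= xL oE.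
  congr (_, _); apply: blowup_vertex_inj => //.
  by rewrite !index_small // -?tx xL.
congr (_, _); apply: blowup_vertex_inj => //.
  by have := ltn_index x; have := ltn_index x'; lia.
by rewrite !index_small // -?ty yL.
Qed.

Lemma blowup1_near_alpha : oriented_near_alpha_valuation b.
Proof.
pose L : {set H} := [set x | tag x \in Vlarge].
exists (~: L), L; split; first exact: b_beta.
- have [v vL] := large_nonempty.
  have Ln0 : L != set0 by apply/set0Pn; exists (copy v 0); rewrite inE.
  have Sn0 : ~: L != set0.
    by apply/set0Pn; exists (copy t 0); rewrite !inE -smallE.
  have ne : ~: L != L.
    by apply/eqP => /setP /(_ (copy v 0)); rewrite !inE vL.
  split=> //; apply/and3P; split.
  + by rewrite /cover big_setU1 ?inE //= big_set1 setUC setUCr.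
  + apply/trivIsetP => A B; rewrite !inE.
    by case/orP=> /eqP -> /orP[]/eqP ->; rewrite ?eqxx // => _;
       rewrite -setI_eq0 ?setICr // setIC setICr.
  + by rewrite !inE !negb_or ![set0 == _]eq_sym Ln0 Sn0.
- move=> x y; rewrite !inE => xL xy; apply: label_lt => //.
  case/orP: (xy) => [/(@arc_smallNlarge (tag x))|/(@arc_smallNlarge (tag y))->//].
  by rewrite (negPf xL) => /esym/negbFE.
- by move=> x y; rewrite inE => xL xy; apply: label_lt; rewrite // /adjacent orbC.
Qed.

End BlowUpLarge.

Theorem theorem5p15 (G : digraph) (p : G -> 'I_(narcs G).+1)
    (Vsmall Vlarge : {set G}) (l : nat)
    (hp : oriented_near_alpha_with p Vsmall Vlarge) (hl : 0 < l) :
  exists b : blowup1 Vlarge l -> 'I_(narcs (blowup1 Vlarge l)).+1,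
    oriented_near_alpha_valuation b.
Proof.
have [t tS] := small_nonempty hp.
eexists; exact: (blowup1_near_alpha hp hl tS).
Qed.
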